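(* Let $\gamma(t)$ be a centroaffine curve with centroaffine curvature $p(t)$, and let $k$ be the curvature of its dual curve $\gamma^*\subset H^2$. Then $$k=\frac{1-p}{1+p}\qquad\text{or}\qquad (1+p)(1+k)=2.$$
   Context: A centroaffine curve is a smooth curve $\gamma(t)=(x(t),y(t))$ in $\mathbb{R}^2$ with $xy'-x'y=1$; it is assumed $\pi$-anti-periodic, $\gamma(t+\pi)=-\gamma(t)$. Its centroaffine curvature is the function $p$ with $\gamma''=p\gamma$. The 3-dimensional space of quadratic forms $aX^2+2bXY+cY^2$, with coordinates $(a,b,c)$, carries the pseudo-Euclidean metric given by the quadratic form $b^2-ac$. The hyperbolic plane $H^2$ is the pseudo-sphere $\{ac-b^2=1,\ a+c>0\}$ with the induced metric; its points correspond to the unit central ellipses $aX^2+2bXY+cY^2=1$ (those of area $\pi$). The osculating ellipse of $\gamma$ at the point $\gamma(t)$ is the unit central ellipse tangent to $\gamma$ at this point; as $t$ varies, the corresponding points of $H^2$ form the dual curve $\gamma^*(t)$. Explicitly, $\gamma^*=(y^2+y'^2,\,-(xy+x'y'),\,x^2+x'^2)$. The curvature $k$ of $\gamma^*$ is its curvature as a curve in the hyperbolic plane $H^2$, determined by the projection to the pseudo-sphere (i.e. to its tangent plane) of the second derivative of $\gamma^*$ with respect to an arc length parameter. When $p=-1$ the formula is read as giving $k=\infty$ (for instance, if $\gamma$ is a unit central ellipse, $p=-1$ and the dual curve is a point). *)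

(* Defs.v *)
From Stdlib Require Import Reals.
From Coquelicot Require Import Coquelicot.
Open Scope R_scope.

Definition smooth (f : R -> R) : Prop := forall n t, ex_derive_n f n t.

Definition centroaffine (x y : R -> R) : Prop :=
  smooth x /\ smooth y /\
  (forall t, x t * Derive y t - Derive x t * y t = 1) /\
  (forall t, x (t + PI) = - x t /\ y (t + PI) = - y t).

Definition centroaffine_curvature (x y p : R -> R) : Prop :=
  forall t, Derive_n x 2 t = p t * x t /\ Derive_n y 2 t = p t * y t.

(* [QForm a b c] is the quadratic form a X^2 + 2 b X Y + c Y^2. *)
Record qform := QForm { qa : R; qb : R; qc : R }.

Definition qzero : qform := QForm 0 0 0.
Definition qadd (q r : qform) : qform :=
  QForm (qa q + qa r) (qb q + qb r) (qc q + qc r).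
Definition qscale (m : R) (q : qform) : qform :=
  QForm (m * qa q) (m * qb q) (m * qc q).

Definition qeval (q : qform) (X Y : R) : R :=
  qa q * X ^ 2 + 2 * qb q * X * Y + qc q * Y ^ 2.

(* Symmetric bilinear form of the metric: qdot q q = b^2 - a c. *)
Definition qdot (q r : qform) : R :=
  qb q * qb r - (qa q * qc r + qc q * qa r) / 2.

Definition in_H2 (q : qform) : Prop :=
  qa q * qc q - qb q ^ 2 = 1 /\ 0 < qa q + qc q.

(* The ellipse q = 1 passes through (x t, y t), and q restricted to the curve
   is critical at t, i.e. the velocity lies in the tangent line of q = 1. *)
Definition osculating_ellipse (x y : R -> R) (t : R) (q : qform) : Prop :=
  in_H2 q /\ qeval q (x t) (y t) = 1 /\
  Derive (fun u => qeval q (x u) (y u)) t = 0.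

Definition dual_curve (x y : R -> R) (G : R -> qform) : Prop :=
  forall t, osculating_ellipse x y t (G t).

Definition qDerive (G : R -> qform) (t : R) : qform :=
  QForm (Derive (fun u => qa (G u)) t)
        (Derive (fun u => qb (G u)) t)
        (Derive (fun u => qc (G u)) t).

(* The metric is positive definite on tangent planes of H^2. *)
Definition speed (G : R -> qform) (t : R) : R :=
  sqrt (qdot (qDerive G t) (qDerive G t)).

(* d/ds along G, for the arc length parameter s with ds = speed dt. *)
Definition arc_derive (G F : R -> qform) (t : R) : qform :=
  qscale (/ speed G t) (qDerive F t).

(* Orthogonal projection to the tangent plane of H^2 at q, where qdot q q = -1. *)
Definition tangent_proj (q v : qform) : qform :=
  qadd v (qscale (qdot v q) q).

Definition unit_normal (G : R -> qform) (t : R) (n : qform) : Prop :=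
  qdot n (G t) = 0 /\ qdot n (qDerive G t) = 0 /\ qdot n n = 1.

(* Curvature of the curve G in H^2 with respect to the unit normal n at G t,
   with values in the projective line R u {oo}: [None] stands for oo, taken
   where G has zero velocity.  The second derivative in arc length, hence the
   curvature for a given normal, does not depend on the direction of G. *)
Definition curvature (G : R -> qform) (n : qform) (t : R) : option R :=
  if Req_EM_T (speed G t) 0 then None
  else Some (qdot (tangent_proj (G t) (arc_derive G (arc_derive G G) t)) n).

(* The sign of the curvature of the dual curve requires a co-orientation.
   The dual curve is the envelope of the horocycles formed by the unit central
   ellipses through (x t, y t); its normal is the one pointing to the side
   q (x t, y t) > 1 of the horocycle, i.e. to the ellipses leaving (x t, y t)
   outside.  This choice stays continuous through the cusps of the dual curve;
   where 1 + p > 0 it is the normal n with det (G, G', n) > 0 in (a, b, c). *)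
Definition dual_normal (x y : R -> R) (G : R -> qform) (t : R) (n : qform) : Prop :=
  unit_normal G t n /\ 0 < qeval n (x t) (y t).

(* Main.v *)
Require Import Defs.
From Stdlib Require Import Reals Lra.
From Coquelicot Require Import Coquelicot.
Open Scope R_scope.

(** Everything is read in the moving frame gamma = (x, y), gamma' = (x', y'),
    which has determinant 1.  For vectors P, Q let P.Q ([mix]) be the quadratic
    form whose value at Z is 2 det(P, Z) det(Q, Z).  The metric pairs a quadratic form q with P.Q to give minus the polar
    value q(P, Q) ([qdot_mix]), so a form is known from its Gram matrix on the
    frame, and its square norm is minus the determinant of that matrix.

    The Gram matrix of an osculating ellipse has q(gamma, gamma) = 1,
    q(gamma, gamma') = 0 and determinant 1, so it is the identity and
    gamma^* = (gamma.gamma + gamma'.gamma') / 2 ([osculating_ellipse_eq]).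
    Since gamma'' = p gamma, differentiation gives
    gamma^*' = (1 + p) gamma.gamma', and gamma.gamma' has length 1.  The speed
    is therefore |1 + p|, which vanishes exactly where p = -1, and otherwise the
    unit tangent is E = gamma.gamma' up to a locally constant sign, because p is
    continuous.  That sign cancels in the second arc length derivative, which is
    E' / (1 + p) = (gamma'.gamma' + p gamma.gamma) / (1 + p).

    Orthogonality of the unit normal n to gamma^* and to E says
    n(gamma, gamma) + n(gamma', gamma') = 0 and n(gamma, gamma') = 0; unit
    length and the co-orientation then force n(gamma, gamma) = 1 and
    n(gamma', gamma') = -1 ([normal_gram]).  Pairing the second derivative with
    n gives (1 - p) / (1 + p); the projection to the tangent plane only adds a
    multiple of gamma^*, which n annihilates. *)

(** * Quadratic forms in a unimodular frame *)

Definition qpolar (q : qform) (X Y Z W : R) : R :=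
  qa q * X * Z + qb q * (X * W + Y * Z) + qc q * Y * W.

(** The symmetric product of the linear forms det((X, Y), .) and
    det((Z, W), .), times 2. *)
Definition mix (X Y Z W : R) : qform :=
  QForm (2 * Y * W) (- (X * W + Y * Z)) (2 * X * Z).

Lemma qform_ext (q r : qform) :
  qa q = qa r -> qb q = qb r -> qc q = qc r -> q = r.
Proof. destruct q, r; simpl; intros; subst; reflexivity. Qed.

Lemma qdot_sym (q r : qform) : qdot q r = qdot r q.
Proof. unfold qdot; field. Qed.

Lemma qdot_add_l (q r s : qform) : qdot (qadd q r) s = qdot q s + qdot r s.
Proof. unfold qdot; simpl; field. Qed.

Lemma qdot_scale_l (m : R) (q s : qform) : qdot (qscale m q) s = m * qdot q s.
Proof. unfold qdot; simpl; field. Qed.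

Lemma qeval_polar (q : qform) (X Y : R) : qeval q X Y = qpolar q X Y X Y.
Proof. unfold qeval, qpolar; ring. Qed.

Lemma qdot_mix (q : qform) (X Y Z W : R) :
  qdot q (mix X Y Z W) = - qpolar q X Y Z W.
Proof. unfold qdot, qpolar; simpl; field. Qed.

(** The determinant of the Gram matrix of a form is multiplied by the squared
    determinant of the frame. *)
Lemma qdot_gram (q : qform) (x y u v : R) :
  x * v - u * y = 1 ->
  qdot q q = qpolar q x y u v ^ 2 - qpolar q x y x y * qpolar q u v u v.
Proof.
intros h.
transitivity ((x * v - u * y) ^ 2 * (qb q ^ 2 - qa q * qc q)).
- rewrite h; unfold qdot; field.
- unfold qpolar; ring.
Qed.

(** The adjugate of a frame of determinant 1 is its inverse, so a form can be
    rebuilt from its Gram matrix. *)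
Lemma qform_of_gram (q : qform) (x y u v : R) :
  x * v - u * y = 1 ->
  q = qadd (qscale (qpolar q x y x y / 2) (mix u v u v))
        (qadd (qscale (- qpolar q x y u v) (mix x y u v))
              (qscale (qpolar q u v u v / 2) (mix x y x y))).
Proof.
intros h.
assert (h2 : (x * v - u * y) ^ 2 = 1) by (rewrite h; ring).
apply qform_ext; simpl.
- transitivity ((x * v - u * y) ^ 2 * qa q); [rewrite h2; ring|].
  unfold qpolar; field.
- transitivity ((x * v - u * y) ^ 2 * qb q); [rewrite h2; ring|].
  unfold qpolar; field.
- transitivity ((x * v - u * y) ^ 2 * qc q); [rewrite h2; ring|].
  unfold qpolar; field.
Qed.

Lemma qdot_mix_unit (x y u v : R) :
  x * v - u * y = 1 -> qdot (mix x y u v) (mix x y u v) = 1.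
Proof.
intros h; transitivity ((x * v - u * y) ^ 2).
- unfold qdot; simpl; field.
- rewrite h; ring.
Qed.

(** The form for which the frame (x, y), (u, v) is orthonormal. *)
Definition frame_ellipse (x y u v : R) : qform :=
  qscale (/ 2) (qadd (mix x y x y) (mix u v u v)).

(** With r and s the diagonal entries of the Gram matrix of n, orthogonality to
    the frame ellipse says r + s = 0 and orthogonality to the mixed form kills
    the off-diagonal entry.  The norm is then r ^ 2, and the sign condition
    selects r = 1. *)
Lemma normal_gram (n : qform) (x y u v : R) :
  x * v - u * y = 1 ->
  qdot n (frame_ellipse x y u v) = 0 -> qdot n (mix x y u v) = 0 ->
  qdot n n = 1 -> 0 < qeval n x y ->
  qpolar n x y x y = 1 /\ qpolar n u v u v = -1.
Proof.
intros h hG hE hn hpos.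
rewrite qdot_sym in hG; unfold frame_ellipse in hG.
rewrite qdot_scale_l, qdot_add_l, 2!(qdot_sym (mix _ _ _ _)), 2!qdot_mix in hG.
rewrite qdot_mix in hE.
rewrite (qdot_gram n x y u v h) in hn.
rewrite qeval_polar in hpos.
set (r := qpolar n x y x y) in *.
set (s := qpolar n u v u v) in *.
set (m := qpolar n x y u v) in *.
assert (hm : m = 0) by lra.
assert (hs : s = - r) by lra.
rewrite hm, hs in hn.
assert (hr : (r - 1) * (r + 1) = 0) by (ring_simplify in hn; ring_simplify; lra).
destruct (Rmult_integral _ _ hr); split; lra.
Qed.

(** * Derivatives of curves of quadratic forms *)

Lemma qDerive_ext_loc (F G : R -> qform) (t : R) :
  locally t (fun s => F s = G s) -> qDerive F t = qDerive G t.
Proof.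
intros h; apply qform_ext; simpl; apply Derive_ext_loc;
  refine (filter_imp _ _ _ h); intros s hs; rewrite hs; reflexivity.
Qed.

Lemma qDerive_scale (m : R) (F : R -> qform) (t : R) :
  qDerive (fun s => qscale m (F s)) t = qscale m (qDerive F t).
Proof. apply qform_ext; simpl; apply Derive_scal. Qed.

Lemma qDerive_mix (f g h k : R -> R) (f' g' h' k' t : R) :
  is_derive f t f' -> is_derive g t g' -> is_derive h t h' ->
  is_derive k t k' ->
  qDerive (fun s => mix (f s) (g s) (h s) (k s)) t =
  qadd (mix f' g' (h t) (k t)) (mix (f t) (g t) h' k').
Proof.
intros hf hg hh hk.
assert (ef : ex_derive f t) by (eexists; exact hf).
assert (eg : ex_derive g t) by (eexists; exact hg).
assert (eh : ex_derive h t) by (eexists; exact hh).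
assert (ek : ex_derive k t) by (eexists; exact hk).
rewrite <- (is_derive_unique _ _ _ hf), <- (is_derive_unique _ _ _ hg),
  <- (is_derive_unique _ _ _ hh), <- (is_derive_unique _ _ _ hk).
apply qform_ext; simpl; apply is_derive_unique; auto_derive;
  try (repeat split; assumption); change (fun s : R => f s) with f; change (fun s : R => g s) with g;
  change (fun s : R => h s) with h; change (fun s : R => k s) with k; ring.
Qed.

Lemma qDerive_frame_ellipse (x y u v : R -> R) (x' y' u' v' t : R) :
  is_derive x t x' -> is_derive y t y' -> is_derive u t u' ->
  is_derive v t v' ->
  qDerive (fun s => frame_ellipse (x s) (y s) (u s) (v s)) t =
  qadd (mix (x t) (y t) x' y') (mix (u t) (v t) u' v').
Proof.
intros hx hy hu hv.
assert (edx : ex_derive x t) by (eexists; exact hx).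
assert (edy : ex_derive y t) by (eexists; exact hy).
assert (edu : ex_derive u t) by (eexists; exact hu).
assert (edv : ex_derive v t) by (eexists; exact hv).
rewrite <- (is_derive_unique _ _ _ hx), <- (is_derive_unique _ _ _ hy),
  <- (is_derive_unique _ _ _ hu), <- (is_derive_unique _ _ _ hv).
apply qform_ext; simpl; apply is_derive_unique; auto_derive;
  try (repeat split; assumption); change (fun s : R => x s) with x; change (fun s : R => y s) with y;
  change (fun s : R => u s) with u; change (fun s : R => v s) with v; field.
Qed.

(** * Centroaffine curves and their dual curves *)

Lemma is_derive_curve (f p : R -> R) (t : R) :
  smooth f -> Derive_n f 2 t = p t * f t ->
  is_derive f t (Derive f t) /\ is_derive (Derive f) t (p t * f t).
Proof.
intros hf hp; split.
- apply Derive_correct; exact (hf 1%nat t).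
- rewrite <- hp; apply Derive_correct; exact (hf 2%nat t).
Qed.

(** The curvature is det(gamma'', gamma'), a polynomial in derivatives of
    gamma, so that it inherits their continuity. *)
Lemma centroaffine_curvature_continuous (x y p : R -> R) (t : R) :
  centroaffine x y -> centroaffine_curvature x y p -> continuous p t.
Proof.
intros [hx [hy [hdet _]]] hp.
assert (hdet2 : forall s,
  Derive_n x 2 s * Derive y s - Derive x s * Derive_n y 2 s = p s).
{ intros s; destruct (hp s) as [-> ->].
  transitivity (p s * (x s * Derive y s - Derive x s * y s));
    [ring | rewrite hdet; ring]. }
apply (continuous_ext _ _ _ hdet2).
assert (hc : forall f, smooth f ->
  continuous (Derive f) t /\ continuous (Derive_n f 2) t).
{ intros f hf; split; apply @ex_derive_continuous;
    [exact (hf 2%nat t) | exact (hf 3%nat t)]. }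
destruct (hc x hx), (hc y hy).
apply @continuous_minus; apply @continuous_mult; assumption.
Qed.

(** Tangency makes the Gram matrix diagonal with first entry 1, and unit
    determinant then fixes the last entry. *)
Lemma osculating_ellipse_eq (x y : R -> R) (t : R) (q : qform) :
  centroaffine x y -> osculating_ellipse x y t q ->
  q = frame_ellipse (x t) (y t) (Derive x t) (Derive y t).
Proof.
intros [hx [hy [hdet _]]] [[hq _] [h1 h0]].
assert (h := hdet t).
assert (edx : ex_derive x t) by exact (hx 1%nat t).
assert (edy : ex_derive y t) by exact (hy 1%nat t).
assert (hm : qpolar q (x t) (y t) (Derive x t) (Derive y t) = 0).
{ assert (hd : Derive (fun u => qeval q (x u) (y u)) t =
    2 * qpolar q (x t) (y t) (Derive x t) (Derive y t)).
  { apply is_derive_unique; unfold qeval, qpolar; auto_derive;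
      [repeat split; assumption |].
    change (fun s : R => x s) with x; change (fun s : R => y s) with y; ring. }
  lra. }
rewrite qeval_polar in h1.
assert (hs : qpolar q (Derive x t) (Derive y t) (Derive x t) (Derive y t) = 1).
{ assert (hg := qdot_gram q _ _ _ _ h).
  rewrite hm, h1 in hg.
  assert (qdot q q = -1) by (unfold qdot; lra).
  lra. }
rewrite (qform_of_gram q _ _ _ _ h), hm, h1, hs.
apply qform_ext; simpl; field.
Qed.

(** The unit tangent of the dual curve, up to sign, continued smoothly through
    the cusps where 1 + p changes sign. *)
Definition unit_tangent (x y : R -> R) (t : R) : qform :=
  mix (x t) (y t) (Derive x t) (Derive y t).

(** In the derivative of (gamma.gamma + gamma'.gamma') / 2, the second term
    contributes gamma'.gamma'' = p gamma.gamma', parallel to the first. *)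
Lemma qDerive_dual_curve (x y p : R -> R) (G : R -> qform) (t : R) :
  centroaffine x y -> centroaffine_curvature x y p -> dual_curve x y G ->
  qDerive G t = qscale (1 + p t) (unit_tangent x y t).
Proof.
intros hxy hp hG.
rewrite (qDerive_ext_loc G
  (fun s => frame_ellipse (x s) (y s) (Derive x s) (Derive y s))).
2: { apply filter_forall; intros s; apply osculating_ellipse_eq; auto. }
destruct hxy as [hx [hy _]]; destruct (hp t) as [px py].
destruct (is_derive_curve x p t hx px), (is_derive_curve y p t hy py).
rewrite (qDerive_frame_ellipse x y (Derive x) (Derive y)
  (Derive x t) (Derive y t) (p t * x t) (p t * y t)) by assumption.
apply qform_ext; simpl; ring.
Qed.

Lemma speed_dual_curve (x y p : R -> R) (G : R -> qform) (t : R) :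
  centroaffine x y -> centroaffine_curvature x y p -> dual_curve x y G ->
  speed G t = Rabs (1 + p t).
Proof.
intros hxy hp hG; unfold speed.
rewrite (qDerive_dual_curve x y p G t hxy hp hG).
rewrite qdot_scale_l, qdot_sym, qdot_scale_l.
destruct hxy as [_ [_ [hdet _]]].
unfold unit_tangent; rewrite (qdot_mix_unit _ _ _ _ (hdet t)).
rewrite <- sqrt_Rsqr_abs; f_equal; unfold Rsqr; ring.
Qed.

Lemma qDerive_unit_tangent (x y p : R -> R) (t : R) :
  centroaffine x y -> centroaffine_curvature x y p ->
  qDerive (unit_tangent x y) t =
  qadd (mix (Derive x t) (Derive y t) (Derive x t) (Derive y t))
       (qscale (p t) (mix (x t) (y t) (x t) (y t))).
Proof.
intros [hx [hy _]] hp; destruct (hp t) as [px py].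
destruct (is_derive_curve x p t hx px), (is_derive_curve y p t hy py).
unfold unit_tangent.
rewrite (qDerive_mix x y (Derive x) (Derive y)
  (Derive x t) (Derive y t) (p t * x t) (p t * y t)) by assumption.
apply qform_ext; simpl; ring.
Qed.

(** A continuous function has constant sign near a point where it does not
    vanish. *)
Lemma locally_inv_Rabs_mult (f : R -> R) (t : R) :
  continuous f t -> f t <> 0 ->
  locally t (fun s => / Rabs (f s) * f s = / Rabs (f t) * f t).
Proof.
intros hf h0.
destruct (Rdichotomy _ _ h0) as [hneg | hpos].
- assert (hl : locally t (fun s => f s < 0)).
  { exact (hf (fun r => r < 0) (open_lt 0 (f t) hneg)). }
  refine (filter_imp _ _ _ hl); intros s hs.
  rewrite !Rabs_left by assumption; field; split; lra.
- assert (hl : locally t (fun s => 0 < f s)).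
  { exact (hf (fun r => 0 < r) (open_gt 0 (f t) hpos)). }
  refine (filter_imp _ _ _ hl); intros s hs.
  rewrite !Rabs_pos_eq by lra; field; split; lra.
Qed.

(** Both arc length derivatives carry the sign of 1 + p, which cancels. *)
Lemma arc_derive2_dual_curve (x y p : R -> R) (G : R -> qform) (t : R) :
  centroaffine x y -> centroaffine_curvature x y p -> dual_curve x y G ->
  1 + p t <> 0 ->
  arc_derive G (arc_derive G G) t =
  qscale (/ (1 + p t)) (qDerive (unit_tangent x y) t).
Proof.
intros hxy hp hG hw.
set (sg := / Rabs (1 + p t) * (1 + p t)).
assert (hloc : locally t (fun s =>
  arc_derive G G s = qscale sg (unit_tangent x y s))).
{ assert (hc : continuous (fun s => 1 + p s) t).
  { apply @continuous_plus; [apply continuous_const |].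
    exact (centroaffine_curvature_continuous x y p t hxy hp). }
  refine (filter_imp _ _ _ (locally_inv_Rabs_mult _ t hc hw)); intros s hs.
  unfold arc_derive.
  rewrite (speed_dual_curve x y p G s hxy hp hG).
  rewrite (qDerive_dual_curve x y p G s hxy hp hG).
  unfold sg; rewrite <- hs.
  apply qform_ext; simpl; ring. }
unfold arc_derive at 1.
rewrite (qDerive_ext_loc _ _ t hloc), qDerive_scale.
rewrite (speed_dual_curve x y p G t hxy hp hG).
(* The square of the sign of 1 + p is 1. *)
assert (hsg : / Rabs (1 + p t) * sg = / (1 + p t)).
{ unfold sg.
  assert (ha := Rabs_no_R0 _ hw).
  assert (h2 : Rabs (1 + p t) * Rabs (1 + p t) = (1 + p t) * (1 + p t))
    by exact (eq_sym (Rsqr_abs (1 + p t))).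
  apply (Rmult_eq_reg_l (Rabs (1 + p t) * Rabs (1 + p t)));
    [| apply Rmult_integral_contrapositive; split; assumption].
  transitivity (1 + p t); [field; assumption |].
  rewrite h2; field; assumption. }
rewrite <- hsg; apply qform_ext; simpl; ring.
Qed.

Theorem lemma6p3 (x y p : R -> R) (G n : R -> qform)
  (hxy : centroaffine x y)
  (hp : centroaffine_curvature x y p)
  (hG : dual_curve x y G)
  (hn : forall t, dual_normal x y G t (n t)) :
  forall t,
    (p t <> -1 ->
       exists k, curvature G (n t) t = Some k /\
         k = (1 - p t) / (1 + p t) /\ (1 + p t) * (1 + k) = 2) /\
    (p t = -1 -> curvature G (n t) t = None).
Proof.
intros t; unfold curvature.
assert (hspeed := speed_dual_curve x y p G t hxy hp hG).
split; intros hpt; destruct (Req_EM_T (speed G t) 0) as [h0 | h0].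
- exfalso; apply hpt.
  rewrite hspeed in h0; assert (h := Rabs_eq_0 _ h0); lra.
- assert (hw : 1 + p t <> 0) by lra.
  eexists; split; [reflexivity |].
  destruct (hn t) as [[nG [nG' nn]] npos].
  assert (hdet : x t * Derive y t - Derive x t * y t = 1) by apply hxy.
  assert (nE : qdot (n t) (unit_tangent x y t) = 0).
  { rewrite (qDerive_dual_curve x y p G t hxy hp hG), qdot_sym in nG'.
    rewrite qdot_scale_l, qdot_sym in nG'.
    destruct (Rmult_integral _ _ nG') as [h | h]; [contradiction | exact h]. }
  assert (nF := nG).
  rewrite (osculating_ellipse_eq x y t (G t) hxy (hG t)) in nF.
  destruct (normal_gram (n t) _ _ _ _ hdet nF nE nn npos) as [hr hs].
  unfold tangent_proj.
  rewrite qdot_add_l, (qdot_scale_l _ (G t)), (qdot_sym (G t)), nG.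
  rewrite (arc_derive2_dual_curve x y p G t hxy hp hG hw).
  rewrite (qDerive_unit_tangent x y p t hxy hp).
  rewrite qdot_scale_l, qdot_add_l, qdot_scale_l.
  rewrite !(qdot_sym (mix _ _ _ _)), !qdot_mix, hr, hs.
  split; field; assumption.
- reflexivity.
- exfalso; apply h0; rewrite hspeed, hpt.
  replace (1 + -1) with 0 by ring; apply Rabs_R0.
Qed.
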